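(* Let $p>n$ and consider the linear model $Y=\mathbf{X}\beta^0+\varepsilon$ with a fixed (deterministic) $n\times p$ design matrix $\mathbf{X}$, unknown $\beta^0\in\mathbb{R}^p$ with active set $S_0=\{j:\beta^0_j\neq 0\}$ and $s_0=|S_0|$, and Gaussian error $\varepsilon\sim\mathcal{N}_n(0,\sigma_\varepsilon^2 I)$. Put $\hat\Sigma=\mathbf{X}^T\mathbf{X}/n$ and assume that the compatibility condition holds for $\hat\Sigma$ with compatibility constant $\phi_0^2>0$ and that $\max_j\hat\Sigma_{j,j}\le M^2$ for some $0<M<\infty$. Let $t>0$ be arbitrary. Let $\hat\beta$ be the lasso with $$\lambda\ge 2M\sigma_\varepsilon\sqrt{\frac{2(t^2+\log(p))}{n}},$$ let $\hat\Theta=\hat\Theta_{\mathrm{Lasso}}$ be the nodewise-regression lasso matrix with tuning parameters $\lambda_j>0$ and associated quantities $\hat\tau_j^2$, $j=1,\dots,p$, and let $\hat b_{\mathrm{Lasso}}=\hat\beta+\hat\Theta\mathbf{X}^T(Y-\mathbf{X}\hat\beta)/n$. Then $$\sqrt n(\hat b_{\mathrm{Lasso}}-\beta^0)=W+\Delta,$$ $$W=\hat\Theta\mathbf{X}^T\varepsilon/\sqrt n\sim\mathcal{N}_p(0,\sigma_\varepsilon^2\hat\Omega),\qquad \hat\Omega:=\hat\Theta\hat\Sigma\hat\Theta^T,$$ $$\mathbb{P}\left[\|\Delta\|_\infty\ge 8\sqrt n\left(\max_j\frac{\lambda_j}{\hat\tau_j^2}\right)\frac{\lambda s_0}{\phi_0^2}\right]\le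 2\exp[-t^2].$$
   Context: $X_j$ denotes the $j$th column of $\mathbf{X}$ and $\mathbf{X}_{-j}$ the matrix $\mathbf{X}$ without its $j$th column. Lasso: $\hat\beta:=\arg\min_{\beta\in\mathbb{R}^p}\left(\|Y-\mathbf{X}\beta\|_2^2/n+2\lambda\|\beta\|_1\right)$. Nodewise lasso: for $j=1,\dots,p$, $\hat\gamma_j:=\arg\min_{\gamma\in\mathbb{R}^{p-1}}\left(\|X_j-\mathbf{X}_{-j}\gamma\|_2^2/n+2\lambda_j\|\gamma\|_1\right)$, with components $\hat\gamma_{j,k}$, $k\neq j$, and $\hat\tau_j^2:=\|X_j-\mathbf{X}_{-j}\hat\gamma_j\|_2^2/n+\lambda_j\|\hat\gamma_j\|_1$. Let $\hat C$ be the $p\times p$ matrix with $\hat C_{j,j}=1$ and $\hat C_{j,k}=-\hat\gamma_{j,k}$ for $k\ne j$, and $\hat T^2=\mathrm{diag}(\hat\tau_1^2,\dots,\hat\tau_p^2)$. Then $\hat\Theta_{\mathrm{Lasso}}:=\hat T^{-2}\hat C$ (all $\hat\tau_j^2$ are taken to be positive, so that this is well defined). Compatibility condition for $\hat\Sigma$ with constant $\phi_0^2>0$: for $S\subseteq\{1,\dots,p\}$ let $\beta_S$ be the vector with $\beta_{S,j}=\beta_j 1\{j\in S\}$; for all $\beta\in\mathbb{R}^p$ with $\|\beta_{S_0^c}\|_1\le 3\|\beta_{S_0}\|_1$ one has $\|\beta_{S_0}\|_1^2\le s_0\,\beta^T\hat\Sigma\beta/\phi_0^2$.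
   Formalization: The bound for P[‖Δ‖∞ ≥ …] is proved for s_0 ≥ 1: if s_0 = 0 the threshold is 0, the probability is 1, and the bound fails for t² > log 2. For every s_0 it is proved with > in place of ≥. The lasso is any measurable choice of minimizer. *)

(* Defs.v *)
From HB Require Import structures.
From mathcomp Require Import all_boot all_order all_algebra.
From mathcomp Require Import all_classical all_reals all_analysis.

Set Implicit Arguments.
Unset Strict Implicit.
Unset Printing Implicit Defensive.

Import Order.TTheory GRing.Theory Num.Theory.
Import numFieldNormedType.Exports.

Local Open Scope classical_set_scope.
Local Open Scope ring_scope.

(* Vectors are column vectors; the sup norm is the library's [mx_norm]. *)

Definition l1norm (R : realType) (k : nat) (v : 'cV[R]_k) : R :=
  \sum_(i < k) `|v i 0|.

Definition sq_l2norm (R : realType) (k : nat) (v : 'cV[R]_k) : R :=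
  \sum_(i < k) v i 0 ^+ 2.

Definition active_set (R : realType) (p : nat) (beta : 'cV[R]_p) : {set 'I_p} :=
  [set j | beta j 0 != 0]%SET.

Definition coord_restrict (R : realType) (p : nat) (S : {set 'I_p})
    (beta : 'cV[R]_p) : 'cV[R]_p :=
  \col_j (if j \in S then beta j 0 else 0).

Definition gram (R : realType) (n p : nat) (X : 'M[R]_(n, p)) : 'M[R]_p :=
  n%:R^-1 *: (X^T *m X).

Definition compatibility (R : realType) (p : nat) (Sigma : 'M[R]_p)
    (S : {set 'I_p}) (phi : R) : Prop :=
  forall beta : 'cV[R]_p,
    l1norm (coord_restrict (~: S)%SET beta) <= 3 * l1norm (coord_restrict S beta) ->
    l1norm (coord_restrict S beta) ^+ 2
      <= #|S|%:R * (beta^T *m Sigma *m beta) 0 0 / phi ^+ 2.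

Definition lasso_objective (R : realType) (n p : nat) (X : 'M[R]_(n, p))
    (Y : 'cV[R]_n) (lambda : R) (beta : 'cV[R]_p) : R :=
  sq_l2norm (Y - X *m beta) / n%:R + 2 * lambda * l1norm beta.

(* The minimizer need not be unique (p > n); any one of them qualifies. *)
Definition is_lasso (R : realType) (n p : nat) (X : 'M[R]_(n, p))
    (Y : 'cV[R]_n) (lambda : R) (betahat : 'cV[R]_p) : Prop :=
  forall beta : 'cV[R]_p,
    lasso_objective X Y lambda betahat <= lasso_objective X Y lambda beta.

(* [col' j X] is X without column j.  Column k' of [col' j X] is column
   [lift j k'] of X, so a coefficient gamma_{j,k} with k != j is stored at the
   index k' such that [unlift j k = Some k']. *)
Definition is_nodewise_lasso (R : realType) (n p : nat) (X : 'M[R]_(n, p))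
    (lambda : 'I_p -> R) (gamma : 'I_p -> 'cV[R]_p.-1) : Prop :=
  forall j, is_lasso (col' j X) (col j X) (lambda j) (gamma j).

Definition tau2 (R : realType) (n p : nat) (X : 'M[R]_(n, p))
    (lambda : 'I_p -> R) (gamma : 'I_p -> 'cV[R]_p.-1) (j : 'I_p) : R :=
  sq_l2norm (col j X - col' j X *m gamma j) / n%:R + lambda j * l1norm (gamma j).

Definition Chat (R : realType) (p : nat) (gamma : 'I_p -> 'cV[R]_p.-1) :
    'M[R]_p :=
  \matrix_(j, k) (if unlift j k is Some k' then - gamma j k' 0 else 1).

Definition Theta_lasso (R : realType) (n p : nat) (X : 'M[R]_(n, p))
    (lambda : 'I_p -> R) (gamma : 'I_p -> 'cV[R]_p.-1) : 'M[R]_p :=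
  invmx (diag_mx (\row_j tau2 X lambda gamma j)) *m Chat gamma.

Definition desparsified (R : realType) (n p : nat) (X : 'M[R]_(n, p))
    (Y : 'cV[R]_n) (Theta : 'M[R]_p) (betahat : 'cV[R]_p) : 'cV[R]_p :=
  betahat + n%:R^-1 *: (Theta *m X^T *m (Y - X *m betahat)).

Definition random_vector (R : realType) (d : measure_display)
    (T : measurableType d) (k : nat) (V : T -> 'cV[R]_k) : Prop :=
  forall i, measurable_fun [set: T] (fun w => V w i 0).

(* Law N(m, v) with variance v >= 0, where N(m, 0) is the point mass at m.
   The library's [normal_prob m s] takes the standard deviation, and for s = 0
   it is by convention the uniform law on [0, 1], hence the case split. *)
Definition gaussian (R : realType) (d : measure_display) (T : measurableType d)
    (P : probability T R) (Z : T -> R) (m v : R) : Prop :=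
  [/\ 0 <= v, measurable_fun [set: T] Z &
      forall A : set R, measurable A ->
        P (Z @^-1` A) =
        if v == 0 then (\d_m A)%E else normal_prob m (Num.sqrt v) A].

(* N_k(mu, Sigma), Sigma possibly singular: every linear combination a^T V of
   the coordinates has law N(a^T mu, a^T Sigma a). *)
Definition multivariate_gaussian (R : realType) (d : measure_display)
    (T : measurableType d) (P : probability T R) (k : nat)
    (V : T -> 'cV[R]_k) (mu : 'cV[R]_k) (Sigma : 'M[R]_k) : Prop :=
  Sigma^T = Sigma /\
  forall a : 'cV[R]_k,
    gaussian P (fun w => (a^T *m V w) 0 0)
      ((a^T *m mu) 0 0) ((a^T *m Sigma *m a) 0 0).

(* Main.v *)
(* With S the Gram matrix of X, Y = X beta0 + eps gives
   b - beta0 = Theta X^T eps / n + (I - Theta S) (betahat - beta0), so that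
   Delta = sqrt n (I - Theta S) (betahat - beta0).  The KKT conditions of the
   nodewise lasso bound the entries of row j of I - Theta S by
   lambda_j / tau_j^2.  On the event |X^T eps|_oo / n <= lambda / 2, the basic
   inequality and the compatibility condition bound the l1 norm of
   betahat - beta0 by 4 lambda s0 / phi0^2, hence |Delta|_oo by half of the
   claimed bound; this factor 2 yields the non-strict deviation inequality when
   s0 > 0.  The complementary event has probability at most 2 exp(-t^2), by a
   Gaussian tail estimate and a union bound over the p columns and both signs. *)
Require Import Defs.
From HB Require Import structures.
From mathcomp Require Import all_boot all_order all_algebra.
From mathcomp Require Import all_classical all_reals all_analysis.
From mathcomp Require Import measurable_realfun ring lra.

Set Implicit Arguments.
Unset Strict Implicit.
Unset Printing Implicit Defensive.

Import Order.TTheory GRing.Theory Num.Theory.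
Import numFieldNormedType.Exports.

Local Open Scope classical_set_scope.
Local Open Scope ring_scope.

(** * Norms of column vectors and of their restrictions *)

Lemma sq_l2normE (R : realType) (k : nat) (v : 'cV[R]_k) :
  sq_l2norm v = (v^T *m v) 0 0.
Proof. by rewrite mxE; apply: eq_bigr => i _; rewrite mxE expr2. Qed.

Lemma sq_l2norm_ge0 (R : realType) (k : nat) (v : 'cV[R]_k) : 0 <= sq_l2norm v.
Proof. by apply: sumr_ge0 => i _; exact: sqr_ge0. Qed.

Lemma l1norm_ge0 (R : realType) (k : nat) (v : 'cV[R]_k) : 0 <= l1norm v.
Proof. exact: sumr_ge0. Qed.

Lemma l1norm_coord_restrict (R : realType) (k : nat) (S : {set 'I_k})
    (v : 'cV[R]_k) :
  l1norm (coord_restrict S v) = \sum_(i in S) `|v i 0|.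
Proof.
rewrite [RHS]big_mkcond; apply: eq_bigr => i _; rewrite mxE.
by case: ifP; rewrite ?normr0.
Qed.

Lemma l1norm_coord_restrictC (R : realType) (k : nat) (S : {set 'I_k})
    (v : 'cV[R]_k) :
  l1norm (coord_restrict S v) + l1norm (coord_restrict (~: S)%SET v) = l1norm v.
Proof.
rewrite !l1norm_coord_restrict [RHS](bigID (mem S)) /=; congr +%R.
by apply: eq_bigl => i; rewrite finset.in_setC.
Qed.

(** * First-order optimality conditions of the lasso *)

Lemma sq_l2normBZ (R : realType) (k : nat) (r u : 'cV[R]_k) (s : R) :
  sq_l2norm (r - s *: u) =
  sq_l2norm r - 2 * s * (u^T *m r) 0 0 + s ^+ 2 * sq_l2norm u.
Proof.
rewrite /sq_l2norm mxE !mulr_sumr -sumrB -big_split /=.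
by apply: eq_bigr => i _; rewrite !mxE; ring.
Qed.

(** A first-order condition without derivatives: dividing by a step [s] with the sign of [g] and
    letting it tend to 0 leaves [|g| <= l]. The range [|s| <= 1] is what [lasso_correlation_eq] can
    supply. *)
Lemma slope_le (R : realType) (g c l : R) : 0 <= c ->
  (forall s, `|s| <= 1 -> 2 * s * g <= s ^+ 2 * c + 2 * l * `|s|) -> `|g| <= l.
Proof.
move=> c0 H; rewrite leNgt; apply/negP => lg.
set e := `|g| - l; have e0 : 0 < e by rewrite subr_gt0.
have ce0 : 0 < c + e by lra.
(* This step size gives [h * c < e], while the hypothesis at [h] or [- h], according to the sign of
   [g], yields [2 * e <= h * c]. *)
pose h := e / (c + e).
have h0 : 0 < h by rewrite divr_gt0.
have h1 : h <= 1 by rewrite ler_pdivrMr// mul1r; lra.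
have hE : h * c + h * e = e by rewrite -mulrDr mulfVK// gt_eqF.
have he : 0 < h * e by rewrite mulr_gt0.
have : h * (2 * `|g|) <= h * (h * c + 2 * l).
  have [g0|g0] := leP 0 g.
    by have := H h; rewrite gtr0_norm// => /(_ h1); rewrite ger0_norm//; lra.
  have := H (- h); rewrite normrN gtr0_norm// => /(_ h1).
  by rewrite ltr0_norm//; lra.
by rewrite ler_pM2l// => ?; move: hE he; rewrite /e in e0 *; lra.
Qed.

Section lasso.
Context {R : realType} {n k : nat}.
Variables (X : 'M[R]_(n, k)) (Y : 'cV[R]_n) (lambda : R) (b : 'cV[R]_k).
Hypothesis b_lasso : is_lasso X Y lambda b.

Lemma lasso_variation (v : 'cV[R]_k) (s : R) :
  2 * s * ((v^T *m X^T *m (Y - X *m b)) 0 0 / n%:R)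
  <= s ^+ 2 * (sq_l2norm (X *m v) / n%:R)
     + 2 * lambda * (l1norm (b + s *: v) - l1norm b).
Proof.
have := b_lasso (b + s *: v); rewrite /lasso_objective.
rewrite mulmxDr opprD addrA -scalemxAr sq_l2normBZ trmx_mul !mulrDl.
lra.
Qed.

(** Vary one coordinate only: the l1 norm then grows by at most [|s|]. *)
Lemma lasso_correlation_le (i : 'I_k) : 0 <= lambda ->
  `|(X^T *m (Y - X *m b)) i 0 / n%:R| <= lambda.
Proof.
move=> lambda0.
have -> : (X^T *m (Y - X *m b)) i 0
    = ((delta_mx i 0 : 'cV[R]_k)^T *m X^T *m (Y - X *m b)) 0 0.
  by rewrite trmx_delta -rowE -row_mul [RHS]mxE.
apply: (@slope_le _ _ (sq_l2norm (X *m delta_mx i 0) / n%:R)).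
  by rewrite divr_ge0 ?sq_l2norm_ge0.
move=> s _; apply: (le_trans (lasso_variation _ _)); rewrite lerD2l.
apply: ler_wpM2l; first by rewrite mulr_ge0.
rewrite lerBlDl /l1norm (bigD1 i)//= [X in _ <= X + _](bigD1 i)//=.
rewrite !mxE !eqxx mulr1 addrAC lerD// ?ler_normD//.
by apply: ler_sum => j ji; rewrite !mxE (negbTE ji) mulr0 addr0.
Qed.

(** Vary along [b] itself: for [|s| <= 1] the l1 norm is exactly linear in [s], so [slope_le]
    applies with slope bound 0. *)
Lemma lasso_correlation_eq :
  (b^T *m X^T *m (Y - X *m b)) 0 0 / n%:R = lambda * l1norm b.
Proof.
apply/eqP; rewrite -subr_eq0 -normr_le0.
apply: (@slope_le _ _ (sq_l2norm (X *m b) / n%:R)).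
  by rewrite divr_ge0 ?sq_l2norm_ge0.
move=> s s1.
have sE : l1norm (b + s *: b) = (1 + s) * l1norm b.
  rewrite /l1norm mulr_sumr; apply: eq_bigr => i _.
  rewrite !mxE -[X in X + _]mul1r -mulrDl normrM ger0_norm//.
  by move: s1; rewrite ler_norml => /andP[? _]; lra.
have := lasso_variation b s; rewrite sE; lra.
Qed.
End lasso.

(** * Nodewise regression as an approximate inverse of the Gram matrix *)

Section nodewise.
Context {R : realType} {n p : nat}.
Variables (X : 'M[R]_(n, p)) (lambda : 'I_p -> R) (gamma : 'I_p -> 'cV[R]_p.-1).
Hypothesis lambda_ge0 : forall j, 0 <= lambda j.
Hypothesis gamma_lasso : is_nodewise_lasso X lambda gamma.
Hypothesis tau2_gt0 : forall j, 0 < tau2 X lambda gamma j.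

Lemma row_Chat_mul (j : 'I_p) :
  row j (Chat gamma *m X^T) = (col j X - col' j X *m gamma j)^T.
Proof.
apply/rowP => i; rewrite !mxE (bigD1_ord j)//= !mxE unlift_none mul1r; congr +%R.
by rewrite -sumrN; apply: eq_bigr => m _; rewrite !mxE liftK mulNr mulrC.
Qed.

Lemma row_Theta_mul (j : 'I_p) :
  row j (Theta_lasso X lambda gamma *m X^T)
  = (tau2 X lambda gamma j)^-1 *: (col j X - col' j X *m gamma j)^T.
Proof.
rewrite -row_Chat_mul /Theta_lasso; set D := diag_mx _.
have Dinv : invmx D = diag_mx (\row_i (tau2 X lambda gamma i)^-1).
  have DK : diag_mx (\row_i (tau2 X lambda gamma i)^-1) *m D = 1%:M.
    rewrite mulmx_diag -[RHS]diag_const_mx; congr diag_mx; apply/rowP => i.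
    by rewrite !mxE mulVf// gt_eqF.
  have [_ uD] := mulmx1_unit DK.
  by rewrite -[LHS]mul1mx -DK mulmxK.
by rewrite Dinv -mulmxA row_mul row_diag_mx mxE -scalemxAl -rowE.
Qed.

(** Entry [(j, k)] of [Theta *m gram X] is the inner product of column [k] with the residual of the
    [j]-th nodewise regression, over [n] times [tau2] at [j]. Off the diagonal,
    [lasso_correlation_le] bounds it. *)
Lemma nodewise_approx_inverse (j k : 'I_p) :
  `|(1%:M - Theta_lasso X lambda gamma *m gram X) j k|
  <= lambda j / tau2 X lambda gamma j.
Proof.
have tau_gt0 := tau2_gt0 j.
have E k' : (Theta_lasso X lambda gamma *m gram X) j k'
    = (tau2 X lambda gamma j)^-1
      * (((col k' X)^T *m (col j X - col' j X *m gamma j)) 0 0 / n%:R).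
  rewrite /gram -scalemxAr mulmxA mxE.
  have -> (A : 'M[R]_(p, n)) : (A *m X) j k' = ((col k' X)^T *m (row j A)^T) 0 0.
    by rewrite -trmx_mul colE mulmxA -colE -row_mul [RHS]mxE [RHS]mxE [RHS]mxE.
  by rewrite row_Theta_mul linearZ /= trmxK -scalemxAr mxE; ring.
rewrite mxE [X in _ + X]mxE E mxE.
have [<-|jk] := eqVneq j k.
  (* The KKT equation [gamma^T X_{-j}^T res / n = lambda |gamma|_1] makes the
     diagonal entry exactly 1. *)
  rewrite (_ : _ / n%:R = tau2 X lambda gamma j).
    by rewrite mulVf ?gt_eqF// subrr normr0 divr_ge0// ltW.
  rewrite /tau2 -(lasso_correlation_eq (gamma_lasso j)) sq_l2normE -mulrDl.
  rewrite -trmx_mul; set Xg := col' j X *m gamma j; congr (_ / _).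
  by rewrite -{1}[col j X](subrK Xg) [(_ + Xg)^T]linearD mulmxDl mxE.
have [k' -> _] := unlift_some jk.
rewrite sub0r normrN normrM gtr0_norm ?invr_gt0//.
rewrite mulrC ler_pM2r ?invr_gt0//.
rewrite (_ : ((_ *m _) 0 0) = ((col' j X)^T *m (col j X - col' j X *m gamma j)) k' 0).
  exact: lasso_correlation_le.
by rewrite !mxE; apply: eq_bigr => i _; rewrite !mxE.
Qed.
End nodewise.

(** * The l1 estimation error of the lasso *)

(* [Q] stands for the prediction error, [d] and [dS] for the l1 norms of the
   estimation error and of its restriction to the active set. *)
Lemma compat_l1_bound (R : realType) (Q d dS lambda K : R) :
  0 < lambda -> 0 <= K -> 0 <= Q -> dS ^+ 2 <= K * Q ->
  Q + lambda * d <= 4 * lambda * dS -> d <= 4 * (lambda * K).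
Proof.
move=> l0 K0 Q0 dSQ Qd; rewrite -(ler_pM2l l0).
suff : 4 * lambda * dS <= Q + lambda * (4 * (lambda * K)) by lra.
move: K0; rewrite le_eqVlt => /predU1P[K0|K0].
  move: dSQ; rewrite -K0 mul0r => dS0.
  have /eqP-> : dS == 0 by rewrite -sqrf_eq0 eq_le dS0 sqr_ge0.
  by rewrite !mulr0 addr0.
(* Multiplied by [K], the goal follows from [2ab <= a^2 + b^2] with [a = 2 * lambda * K] and
   [b = dS], since [dS ^+ 2 <= K * Q]. *)
rewrite -(ler_pM2l K0).
by have := sqr_ge0 (2 * lambda * K - dS); lra.
Qed.

Lemma l1norm_lasso_error (R : realType) (n p : nat)
    (X : 'M[R]_(n, p)) (beta0 b : 'cV[R]_p) (e : 'cV[R]_n) (lambda phi : R) :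
  0 < lambda ->
  compatibility (gram X) (active_set beta0) phi ->
  (forall j, `|(X^T *m e) j 0 / n%:R| <= lambda / 2) ->
  is_lasso X (X *m beta0 + e) lambda b ->
  l1norm (b - beta0) <= 4 * (lambda * #|active_set beta0|%:R / phi ^+ 2).
Proof.
move=> l0 compat noise b_lasso.
set S := active_set beta0 in compat *; set delta := b - beta0.
set Q := sq_l2norm (X *m delta) / n%:R.
have Q0 : 0 <= Q by rewrite divr_ge0 ?sq_l2norm_ge0.
set dS := l1norm (coord_restrict S delta).
set dC := l1norm (coord_restrict (~: S)%SET delta).
have dE : l1norm delta = dS + dC by rewrite l1norm_coord_restrictC.
have dS0 : 0 <= dS := l1norm_ge0 _.
have dC0 : 0 <= dC := l1norm_ge0 _.
have noise_le : (delta^T *m X^T *m e) 0 0 / n%:R <= lambda / 2 * l1norm delta.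
  rewrite -mulmxA mxE mulr_suml mulr_sumr; apply: ler_sum => j _.
  rewrite mxE -mulrA mulrC (le_trans (ler_norm _))// normrM.
  by rewrite ler_wpM2r.
(* Off [S], [beta0] vanishes and [b] equals [delta]; on [S] this is the reverse triangle
   inequality. *)
have l1_le : l1norm beta0 - l1norm b <= dS - dC.
  rewrite /dS /dC !l1norm_coord_restrict /l1norm -sumrB.
  rewrite [X in _ <= X - _]big_mkcond [X in _ <= _ - X]big_mkcond -sumrB /=.
  apply: ler_sum => j _.
  rewrite finset.in_setC /S inE /delta !mxE.
  have [b0|_]/= := eqVneq (beta0 j 0) 0.
    by rewrite b0 subr0 normr0.
  by rewrite subr0 distrC lerB_dist.
(* Comparison with [beta0]; the factor 2 of the cross term turns the noise level [lambda / 2] into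
   [lambda]. *)
have basic : Q + 2 * lambda * (l1norm b - l1norm beta0) <= lambda * l1norm delta.
  have := b_lasso beta0; rewrite /lasso_objective [X *m beta0 + e]addrC addrK.
  rewrite (_ : e + X *m beta0 - X *m b = e - 1 *: (X *m delta)); last first.
    by rewrite scale1r /delta mulmxBr opprB addrA.
  rewrite sq_l2normBZ trmx_mul expr1n mul1r !mulrDl.
  rewrite -/Q; lra.
have cone : Q + lambda * dC <= 3 * lambda * dS.
  move: basic; rewrite dE; nra.
have dC_le : dC <= 3 * dS by rewrite -(ler_pM2l l0); lra.
have := compat delta dC_le.
have -> : (delta^T *m gram X *m delta) 0 0 = Q.
  rewrite /gram -scalemxAr -scalemxAl mxE /Q sq_l2normE trmx_mul.
  by rewrite !mulmxA mulrC.
rewrite -/dS; set K := #|S|%:R / phi ^+ 2; rewrite mulrAC -/K => dSQ.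
rewrite -[lambda * _ / _]mulrA -/K.
have K0 : 0 <= K by rewrite divr_ge0// sqr_ge0.
(* Adding [lambda * dS] to both sides of [cone] turns its constant 3 into 4. *)
by apply: (compat_l1_bound l0 K0 Q0 dSQ); rewrite dE; lra.
Qed.

(** * Gaussian tails and the union bound *)

Lemma normal_prob_tail (R : realType) (s x : R) : 0 < s -> 0 <= x ->
  (normal_prob 0 s [set z | (x <= z)%R] <= (expR (- x ^+ 2 / (s ^+ 2 *+ 2)))%:E)%E.
Proof.
move=> s0 x0; set c := expR _; set D := [set z | _].
have mD : measurable D by rewrite /D -set_itvcy; exact: measurable_itv.
have mpdf (m : R) : measurable_fun D (EFin \o normal_pdf m s).
  apply/measurable_EFinP; apply: measurable_funTS; exact: measurable_normal_pdf.
(* Shift of the mean: for [z >= x >= 0], [z^2 >= x^2 + (z - x)^2], so the density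
   of N(0, s^2) at [z] is at most [c] times that of N(x, s^2). *)
apply: (@le_trans _ _ (\int[lebesgue_measure]_(z in D) (c%:E * (normal_pdf x s z)%:E))%E).
  apply: ge0_le_integral => //=.
  - by move=> z _; rewrite lee_fin normal_pdf_ge0.
  - exact: mpdf.
  - by apply: measurable_funeM; exact: mpdf.
  move=> z /= xz; rewrite -EFinM lee_fin !normal_pdfE ?gt_eqF//.
  rewrite mulrCA ler_wpM2l ?normal_peak_ge0// /normal_fun /c -expRD ler_expR.
  rewrite -mulrDl ler_wpM2r ?invr_ge0 ?mulrn_wge0 ?sqr_ge0//.
  have : 0 <= x * (z - x) by rewrite mulr_ge0 ?subr_ge0.
  by rewrite subr0; lra.
rewrite ge0_integralZl_EFin ?expR_ge0//=; last 2 first.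
- by move=> z _; rewrite lee_fin normal_pdf_ge0.
- exact: mpdf.
rewrite -[leRHS]mule1 lee_wpmul2l ?lee_fin ?expR_ge0//.
exact: (@probability_le1 _ _ _ (normal_prob x s)).
Qed.

(** An upper bound [u] replaces the variance so that one estimate serves all columns of the design,
    including those of variance 0. *)
Lemma gaussian_tail (R : realType) (d : measure_display) (T : measurableType d)
    (P : probability T R) (Z : T -> R) (v u x : R) :
  gaussian P Z 0 v -> v <= u -> 0 < u -> 0 < x ->
  (P [set w | (x <= Z w)%R] <= (expR (- (x ^+ 2 / (2 * u))))%:E)%E.
Proof.
move=> [v0 mZ law] vu u0 x0.
have mx : measurable [set z : R | x <= z].
  by rewrite -set_itvcy; exact: measurable_itv.
have := law _ mx; rewrite /preimage /= => ->.
(* For [v = 0] the law is the point mass at 0, which the half-line misses because [x > 0]. *)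
have [_|vn0] := eqVneq v 0.
  by rewrite diracE memNset ?lee_fin ?expR_ge0//= leNgt x0.
have v_gt0 : 0 < v by rewrite lt_neqAle eq_sym vn0.
apply: (le_trans (normal_prob_tail _ (ltW x0))); first by rewrite sqrtr_gt0.
rewrite lee_fin ler_expR sqr_sqrtr// mulNr lerN2 ler_wpM2l ?sqr_ge0//.
by rewrite -[v *+ 2]mulr_natl lef_pV2 ?posrE ?mulr_gt0// ler_pM2l.
Qed.

Lemma measure_le_bigsetU (R : realType) (d : measure_display)
    (T : measurableType d) (P : {measure set T -> \bar R}) (I : finType)
    (A : I -> set T) (B : set T) (c : I -> \bar R) :
  measurable B -> (forall i, measurable (A i)) ->
  (forall i, (P (A i) <= c i)%E) -> B `<=` \bigcup_i A i ->
  (P B <= \sum_i c i)%E.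
Proof.
move=> mB mA PA BA.
suff [mU PU] : measurable (\big[setU/set0]_i A i) /\
    (P (\big[setU/set0]_i A i) <= \sum_i c i)%E.
  apply: le_trans PU; apply: le_measure; rewrite ?inE//.
  by apply: (subset_trans BA) => w [i _ Aiw]; rewrite (bigD1 i)//=; left.
apply: (big_ind2 (fun U x => measurable U /\ (P U <= x)%E)).
- by rewrite measure0.
- move=> U x V y [mU Ux] [mV Vy]; split; first exact: measurableU.
  by apply: le_trans (leeD Ux Vy); exact: measureU2.
- by move=> i _; split; [exact: mA | exact: PA].
Qed.

(** An arbitrary measurable [B] inside the large-noise event is allowed, so that both the strict and
    the non-strict deviation events are covered. *)
Lemma gaussian_noise_tail (R : realType) (d : measure_display)
    (T : measurableType d) (P : probability T R) (n p : nat)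
    (n_gt0 : (0 < n)%N) (p_gt0 : (0 < p)%N) (X : 'M[R]_(n, p)) (sigma M t : R)
    (eps : T -> 'cV[R]_n) (B : set T) :
  0 < sigma -> 0 < M -> 0 < t -> (forall j, gram X j j <= M ^+ 2) ->
  multivariate_gaussian P eps 0 (sigma ^+ 2 *: 1%:M) -> measurable B ->
  (forall w, B w -> exists j : 'I_p,
    M * sigma * Num.sqrt (2 * (t ^+ 2 + ln p%:R) / n%:R)
      <= `|(X^T *m eps w) j 0 / n%:R|) ->
  (P B <= (2 * expR (- t ^+ 2))%:E)%E.
Proof.
move=> s0 M0 t0 diag_le [_ epsG] mB.
set c := 2 * (t ^+ 2 + ln p%:R) / n%:R => B_sub.
have n0 : 0 < n%:R :> R by rewrite ltr0n.
have p0 : 0 < p%:R :> R by rewrite ltr0n.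
have c0 : 0 < c.
  rewrite divr_gt0// mulr_gt0// ltr_pwDl ?exprn_gt0//.
  by rewrite ln_ge0// ler1n.
(* With these [x] and [u], [x ^+ 2 / (2 * u) = n * c / 2 = t ^+ 2 + ln p], so each one-sided tail is
   at most [expR (- t ^+ 2) / p]. *)
pose x := n%:R * (M * sigma * Num.sqrt c).
have x0 : 0 < x by rewrite !mulr_gt0// sqrtr_gt0.
pose u := sigma ^+ 2 * (n%:R * M ^+ 2).
have u0 : 0 < u by rewrite !mulr_gt0// exprn_gt0.
(* The boolean carries a sign, splitting each absolute value into two one-sided events: [2 * p]
   events in all. *)
pose v (i : 'I_p * bool) : 'cV[R]_n := (-1) ^+ i.2 *: col i.1 X.
pose A (i : 'I_p * bool) := [set w | (x <= ((v i)^T *m eps w) 0 0)%R].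
have vE i w : ((v i)^T *m eps w) 0 0 = (-1) ^+ i.2 * (X^T *m eps w) i.1 0.
  rewrite linearZ -scalemxAl mxE; congr (_ * _).
  by rewrite !mxE; apply: eq_bigr => k _; rewrite !mxE.
have varE i : ((v i)^T *m (sigma ^+ 2 *: 1%:M) *m v i) 0 0 <= u.
  rewrite scalemx1 mul_mx_scalar -scalemxAl mxE ler_wpM2l ?sqr_ge0//.
  rewrite /v [(_ *: _)^T]linearZ /= -scalemxAl -scalemxAr !mxE mulrA -expr2.
  rewrite sqrr_sign mul1r.
  have := diag_le i.1; rewrite !mxE ler_pdivrMl// => h.
  apply: le_trans h; rewrite le_eqVlt; apply/orP; left; apply/eqP.
  by apply: eq_bigr => k _; rewrite !mxE.
have tail i : (P (A i) <= (expR (- t ^+ 2) / p%:R)%:E)%E.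
  have := epsG (v i); rewrite mulmx0 [X in gaussian _ _ X]mxE => epsGv.
  apply: (le_trans (gaussian_tail epsGv (varE i) u0 x0)).
  rewrite lee_fin -[X in _ <= _ / X]lnK ?posrE// -expRN -expRD ler_expR -opprD lerN2.
  rewrite le_eqVlt; apply/orP; left; apply/eqP.
  rewrite /x /u !exprMn sqr_sqrtr ?ltW// /c; field.
  by rewrite !gt_eqF.
have mA i : measurable (A i).
  have [_ mf _] := epsG (v i).
  rewrite -[A i]setTI.
  exact: (measurable_fun_le).
have sumE : (2 * expR (- t ^+ 2))%:E
    = (\sum_(i : 'I_p * bool) (expR (- t ^+ 2) / p%:R)%:E)%E.
  rewrite sumEFin sumr_const card_prod card_ord card_bool; congr EFin.
  rewrite -[RHS]mulr_natr natrM; field.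
  by rewrite gt_eqF.
rewrite sumE; apply: (measure_le_bigsetU mB mA tail) => w /B_sub[j].
rewrite normrM normfV (gtr0_norm n0) ler_pdivlMr// mulrC -/x => xj.
exists (j, (X^T *m eps w) j 0 < 0) => //=.
rewrite /A /= vE mulr_sign /=; move: xj; case: ltP => h.
  by rewrite (ltr0_norm h).
by rewrite (ger0_norm h).
Qed.

(** * Measurability, and linear images of random vectors *)

Lemma measurable_mx_norm (R : realType) (d : measure_display)
    (T : measurableType d) (k : nat) (V : T -> 'cV[R]_k) :
  random_vector V -> measurable_fun [set: T] (fun w => mx_norm (V w)).
Proof.
move=> mV; under eq_fun do rewrite mx_normrE.
elim: (index_enum _) => [|i s IH].
  by under eq_fun do rewrite big_nil; exact: measurable_cst.
under eq_fun do rewrite big_cons.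
apply: measurable_maxr => //; apply: measurableT_comp => //.
by rewrite (ord1 i.2); exact: mV.
Qed.

Lemma measurable_affine_image (R : realType) (d : measure_display)
    (T : measurableType d) (k l : nat) (V : T -> 'cV[R]_k) (A : 'M[R]_(l, k))
    (b : 'cV[R]_k) :
  random_vector V -> random_vector (fun w => A *m (V w - b)).
Proof.
move=> mV i; under eq_fun do rewrite mxE.
apply: measurable_sum => j; under eq_fun do rewrite !mxE.
apply: measurable_funM => //; exact: measurable_funB.
Qed.

(** The combination of [A *m V] with coefficients [a] is that of [V] with coefficients
    [A^T *m a]. *)
Lemma multivariate_gaussian_linear (R : realType) (d : measure_display)
    (T : measurableType d) (P : probability T R) (k l : nat)
    (V : T -> 'cV[R]_k) (mu : 'cV[R]_k) (Sigma : 'M[R]_k) (A : 'M[R]_(l, k)) :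
  multivariate_gaussian P V mu Sigma ->
  multivariate_gaussian P (fun w => A *m V w) (A *m mu) (A *m Sigma *m A^T).
Proof.
move=> [symS gV]; split; first by rewrite !trmx_mul trmxK symS mulmxA.
move=> a; rewrite (_ : (fun w => _) = fun w => (a^T *m A *m V w) 0 0).
  by have := gV (A^T *m a); rewrite trmx_mul trmxK !mulmxA.
by apply/funext => w; rewrite mulmxA.
Qed.

Lemma mx_norm_mul_le (R : realType) (k l : nat) (A : 'M[R]_(l, k)) (v : 'cV[R]_k)
    (c : R) :
  0 <= c -> (forall i j, `|A i j| <= c) -> mx_norm (A *m v) <= c * l1norm v.
Proof.
move=> c0 Ac; rewrite mx_normrE; apply: bigmax_le.
  by rewrite mulr_ge0// l1norm_ge0.
move=> [i j] _ /=; rewrite (ord1 j) mxE mulr_sumr.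
apply: (le_trans (ler_norm_sum _ _ _)); apply: ler_sum => m _.
by rewrite normrM ler_wpM2r.
Qed.

(** * Decomposition and deviation bound for the desparsified lasso *)

Theorem theorem2p1 (R : realType) (d : measure_display) (T : measurableType d)
    (P : probability T R) (n p : nat) (n_gt0 : (0 < n)%N) (ltnp : (n < p)%N)
    (X : 'M[R]_(n, p)) (beta0 : 'cV[R]_p)
    (sigma : R) (sigma_gt0 : 0 < sigma)
    (eps Y : T -> 'cV[R]_n)
    (eps_gaussian : multivariate_gaussian P eps 0 (sigma ^+ 2 *: 1%:M))
    (model : forall w, Y w = X *m beta0 + eps w)
    (phi0 : R) (phi0_gt0 : 0 < phi0)
    (compat : compatibility (gram X) (active_set beta0) phi0)
    (M : R) (M_gt0 : 0 < M) (diag_le : forall j, gram X j j <= M ^+ 2)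
    (t : R) (t_gt0 : 0 < t)
    (lambda : R)
    (lambda_ge :
      2 * M * sigma * Num.sqrt (2 * (t ^+ 2 + ln p%:R) / n%:R) <= lambda)
    (betahat : T -> 'cV[R]_p) (betahat_random : random_vector betahat)
    (betahat_lasso : forall w, is_lasso X (Y w) lambda (betahat w))
    (lambdaj : 'I_p -> R) (lambdaj_gt0 : forall j, 0 < lambdaj j)
    (gammahat : 'I_p -> 'cV[R]_p.-1)
    (gammahat_lasso : is_nodewise_lasso X lambdaj gammahat)
    (tau2_gt0 : forall j, 0 < tau2 X lambdaj gammahat j) :
  let s0 : nat := #|active_set beta0| in
  let Theta : 'M[R]_p := Theta_lasso X lambdaj gammahat in
  let Omega : 'M[R]_p := Theta *m gram X *m Theta^T in
  let bLasso (w : T) : 'cV[R]_p := desparsified X (Y w) Theta (betahat w) in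
  let W (w : T) : 'cV[R]_p := (Num.sqrt n%:R)^-1 *: (Theta *m X^T *m eps w) in
  let bound : R := 8 * Num.sqrt n%:R
    * (\big[Num.max/0]_(j < p) (lambdaj j / tau2 X lambdaj gammahat j))
    * (lambda * s0%:R / phi0 ^+ 2) in
  exists Delta : T -> 'cV[R]_p,
    [/\ forall w, Num.sqrt n%:R *: (bLasso w - beta0) = W w + Delta w,
        multivariate_gaussian P W 0 (sigma ^+ 2 *: Omega),
        (0 < s0)%N ->
          (P [set w | (bound <= mx_norm (Delta w))%R]
             <= (2 * expR (- t ^+ 2))%:E)%E
      & (P [set w | (bound < mx_norm (Delta w))%R]
           <= (2 * expR (- t ^+ 2))%:E)%E].
Proof.
move=> s0 Theta Omega bLasso W bound.
have p_gt0 : (0 < p)%N := leq_ltn_trans (leq0n n) ltnp.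
have n0 : 0 < n%:R :> R by rewrite ltr0n.
have sn0 : 0 < Num.sqrt n%:R :> R by rewrite sqrtr_gt0.
have lambda0 : 0 < lambda.
  apply: lt_le_trans lambda_ge; rewrite !mulr_gt0// sqrtr_gt0.
  by rewrite divr_gt0// mulr_gt0// ltr_pwDl ?exprn_gt0// ln_ge0// ler1n.
pose D := 1%:M - Theta *m gram X.
pose mx := \big[Num.max/0]_(j < p) (lambdaj j / tau2 X lambdaj gammahat j).
have ratio_gt0 j : 0 < lambdaj j / tau2 X lambdaj gammahat j.
  by rewrite divr_gt0.
have ratio_le j : lambdaj j / tau2 X lambdaj gammahat j <= mx.
  exact: le_bigmax.
(* The big maximum defaults to 0, so positivity is read off at an actual index, which exists as
   [0 < p]. *)
have mx_gt0 : 0 < mx := lt_le_trans (ratio_gt0 (Ordinal p_gt0)) (ratio_le _).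
have D_le j k : `|D j k| <= mx.
  apply: le_trans (ratio_le j).
  by apply: nodewise_approx_inverse => // i; exact: ltW.
pose Delta w := (Num.sqrt n%:R *: D) *m (betahat w - beta0).
have bound_ge0 : 0 <= bound.
  by rewrite /bound !mulr_ge0// ?invr_ge0 ?sqr_ge0// ltW.
have mDelta : measurable_fun [set: T] (fun w => mx_norm (Delta w)).
  exact/measurable_mx_norm/measurable_affine_image.
have Delta_le w :
    (forall j, `|(X^T *m eps w) j 0 / n%:R| <= lambda / 2) ->
    mx_norm (Delta w) <= bound / 2.
  move=> noise.
  have bw : is_lasso X (X *m beta0 + eps w) lambda (betahat w) by rewrite -model.
  have l1w := l1norm_lasso_error lambda0 compat noise bw.
  apply: (le_trans (@mx_norm_mul_le _ _ _ _ _ (Num.sqrt n%:R * mx) _ _)).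
  - by rewrite mulr_ge0// ltW.
  - by move=> i j; rewrite mxE normrM gtr0_norm// ler_pM2l.
  have c0 : 0 < Num.sqrt n%:R * mx by rewrite mulr_gt0.
  have := l1w; rewrite -(ler_pM2l c0) => /le_trans; apply.
  by rewrite /bound -/mx /s0; lra.
have tail (B : set T) : measurable B ->
    (forall w, B w -> bound / 2 < mx_norm (Delta w)) ->
    (P B <= (2 * expR (- t ^+ 2))%:E)%E.
  move=> mB B_sub.
  apply: (gaussian_noise_tail n_gt0 p_gt0 sigma_gt0 M_gt0 t_gt0 diag_le
    eps_gaussian mB) => w /B_sub.
  (* By contraposition of [Delta_le], some column has noise above [lambda / 2]; the factor 2 in
     [lambda_ge] puts this above the threshold of [gaussian_noise_tail]. *)
  rewrite ltNge => /negP Bw; apply: contrapT => /forallNP noise; apply/Bw/Delta_le.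
  move=> j; have /negP := noise j; rewrite -ltNge => /ltW/le_trans; apply.
  by rewrite ler_pdivlMr//; apply: le_trans lambda_ge; lra.
exists Delta; split.
- move=> w; rewrite /bLasso /desparsified model /W /Delta.
  set delta := betahat w - beta0.
  have -> : X *m beta0 + eps w - X *m betahat w = eps w - X *m delta.
    by rewrite /delta mulmxBr opprB addrA [eps w + _]addrC.
  have -> : betahat w
      + n%:R^-1 *: (Theta *m X^T *m (eps w - X *m delta)) - beta0
      = n%:R^-1 *: (Theta *m X^T *m eps w) + D *m delta.
    rewrite addrAC -/delta mulmxBr scalerBr /D mulmxBl mul1mx /gram.
    by rewrite -scalemxAr -scalemxAl !mulmxA addrCA.
  rewrite scalerDr scalerA [_ *: (D *m _)]scalemxAl; congr +%R.
  congr *:%R.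
  rewrite -{2}(sqr_sqrtr (ltW n0)); field.
  by rewrite gt_eqF.
- have := multivariate_gaussian_linear
    ((Num.sqrt n%:R)^-1 *: (Theta *m X^T)) eps_gaussian.
  rewrite mulmx0; congr multivariate_gaussian.
    by apply/funext => w; rewrite -scalemxAl.
  rewrite scalemx1 mul_mx_scalar [(_ *: (Theta *m _))^T]linearZ /= -!scalemxAl.
  rewrite -scalemxAr; congr *:%R; rewrite scalerA.
  rewrite /Omega /gram -scalemxAr -scalemxAl trmx_mul trmxK !mulmxA.
  by rewrite -invfM -expr2 sqr_sqrtr ?ltW.
(* A nonempty active set gives [0 < bound], hence [bound / 2 < bound]. For [s0 = 0] the bound is 0
   and this event is the whole space. *)
- move=> s0_gt0; apply: tail.
    by rewrite -[X in measurable X]setTI; exact: measurable_fun_le.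
  move=> w /=; apply: lt_le_trans.
  have : 0 < bound.
    by rewrite /bound -/mx !mulr_gt0// ?invr_gt0 ?exprn_gt0// ltr0n.
  lra.
(* Here strictness comes from the event, so [0 <= bound] suffices. *)
- apply: tail.
    rewrite -[X in measurable X]setTI -preimage_itvoy.
    by apply: mDelta => //; exact: measurable_itv.
  by move=> w /=; apply: le_lt_trans; lra.
Qed.
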